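(* Let $\eta^{ij}$ be a nondegenerate symmetric constant $N\times N$ matrix and let $\psi_n(u)$, $1\le n\le L$, be functions of $u=(u^1,\dots,u^N)$. The nonlinear equations $$\sum_{m=1}^N\sum_{n=1}^N \eta^{mn}\frac{\partial^2\psi_j}{\partial u^i\partial u^m}\frac{\partial^2\psi_k}{\partial u^n\partial u^l} = \sum_{m=1}^N\sum_{n=1}^N \eta^{mn}\frac{\partial^2\psi_k}{\partial u^i\partial u^m}\frac{\partial^2\psi_j}{\partial u^n\partial u^l},\qquad 1\le i,l\le N,\ 1\le j,k\le L,$$ are equivalent to the condition that the integrals $$\Psi_n=\int\psi_n(u(x))\,dx,\qquad 1\le n\le L,$$ are in involution with respect to the Poisson bracket given by the constant Hamiltonian operator $M_2^{ij}=\eta^{ij}\frac{d}{dx}$: $$\{\Psi_n,\Psi_m\}=0,\qquad 1\le n,m\le L.$$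
   Context: The bracket is $\{I,J\}=\int\frac{\delta I}{\delta u^i(x)}\eta^{ij}\frac{d}{dx}\frac{\delta J}{\delta u^j(x)}dx$ on functionals of the fields $u^i(x)$, with summation over repeated upper/lower indices from $1$ to $N$. All considerations are local in $u$; a functional vanishes exactly when its density is a total $x$-derivative (so $\int A_k(u)u^k_x\,dx=0$ iff locally $A_k=\partial S/\partial u^k$ for some function $S(u)$). *)

(* Defs.v *)
From HB Require Import structures.
From mathcomp Require Import all_boot all_order all_algebra.
From mathcomp Require Import all_classical all_reals all_analysis.

Set Implicit Arguments.
Unset Strict Implicit.
Unset Printing Implicit Defensive.

Import Order.TTheory GRing.Theory Num.Theory numFieldNormedType.Exports.

Local Open Scope classical_set_scope.
Local Open Scope ring_scope.

(* All iterated directional derivatives of f are Frechet-differentiable at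
   every point of A; on an open A this is C^oo. *)
Definition smooth_on (R : realType) (V : normedModType R) (A : set V)
    (f : V -> R) : Prop :=
  forall (vs : seq V) (x : V), A x ->
    differentiable (foldr (fun v (g : V -> R) => 'D_v g) f vs) x.

Definition partial (R : realType) (N : nat) (i : 'I_N) (f : 'rV[R]_N -> R) :
    'rV[R]_N -> R :=
  'D_(delta_mx 0 i) f.

Section FormalCalculus.
Context {R : realType} {N : nat}.

(* The formal calculus of variations in one independent variable x: a jet J
   records the formal values of u, u_x, u_xx, ... at a point, J k 0 i being
   the k-th x-derivative of u^i.  Local functionals are represented by their
   densities, which are functions of the jet of finite order. *)
Definition jet : Type := nat -> 'rV[R]_N.

Definition shift_jet (k : nat) (i : 'I_N) (t : R) (J : jet) : jet :=
  fun l => if l == k then J l + t *: delta_mx 0 i else J l.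

Definition jet_partial (k : nat) (i : 'I_N) (f : jet -> R) : jet -> R :=
  fun J => derive1 (fun t : R => f (shift_jet k i t J)) 0.

(* d/dx = \sum_(k, i) u^i_(k+1) d/du^i_(k).  For a density of finite order
   only finitely many k contribute, so that the finitely supported sum over
   nat is the full sum; the same holds for the variational derivative. *)
Definition total_derivative (f : jet -> R) : jet -> R :=
  fun J => \sum_(k \in [set: nat])
    \sum_(i < N) J k.+1 0 i * jet_partial k i f J.

Definition variational_derivative (i : 'I_N) (f : jet -> R) : jet -> R :=
  fun J => \sum_(k \in [set: nat])
    (-1) ^+ k * iter k total_derivative (jet_partial k i f) J.

Definition poisson_bracket (eta : 'M[R]_N) (f g : jet -> R) : jet -> R :=
  fun J => \sum_(i < N) \sum_(j < N)
    variational_derivative i f J *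
    (eta i j * total_derivative (variational_derivative j g) J).

Definition order0_density (psi : 'rV[R]_N -> R) : jet -> R :=
  fun J => psi (J 0%N).

Definition smooth_density (V : set 'rV[R]_N) (g : jet -> R) : Prop :=
  exists (K : nat) (h : 'M[R]_(K.+1, N) -> R),
    smooth_on [set A | V (row 0 A)] h /\
    forall J : jet, V (J 0%N) -> g J = h (\matrix_(k < K.+1) J k).

(* \int f dx = 0 for fields u with values in U, the condition being local
   in u: near each point of U, f is a total x-derivative. *)
Definition functional_vanishes (U : set 'rV[R]_N) (f : jet -> R) : Prop :=
  forall u : 'rV[R]_N, U u ->
  exists V : set 'rV[R]_N,
    [/\ open V, V u, V `<=` U
      & exists g : jet -> R, smooth_density V g /\
          forall J : jet, V (J 0%N) -> f J = total_derivative g J].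

End FormalCalculus.

(* Main.v *)
Require Import Defs.
From HB Require Import structures.
From mathcomp Require Import all_boot all_order all_algebra.
From mathcomp Require Import all_classical all_reals all_analysis.
From mathcomp Require Import ring.

Set Implicit Arguments.
Unset Strict Implicit.
Unset Printing Implicit Defensive.

Import Order.TTheory GRing.Theory Num.Theory numFieldNormedType.Exports.

Local Open Scope classical_set_scope.
Local Open Scope ring_scope.

(* On densities of order zero the bracket is exactly the integral of
   A_l(u) u^l_x with A_l = sum_ij d_i psi_n eta^ij d_l d_j psi_m (bracket_form),
   so involution means that the 1-form A is locally exact.
   By symmetry of second and third derivatives and of eta, the equations of the
   theorem say precisely that A is closed.
   Exact implies closed: if A_l u^l_x is the total derivative of h(u, u_x, ...),
   then A_l is the u^l-derivative of h on the jets (u, 0, 0, ...), and mixed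
   second derivatives of h commute.
   Closed implies exact: integrate A along rays from a point; Frechet
   differentiability of the resulting primitive S comes from the quadratic
   estimate |S y - S x - A(x).(y - x)| <= C |y - x|^2. *)

(** * Sums over jet orders and locality of derivatives *)

Lemma fsum_nat_only0 (R : nzRingType) (F : nat -> R) :
  (forall k, (0 < k)%N -> F k = 0) -> \sum_(k \in [set: nat]) F k = F 0%N.
Proof.
move=> F0; rewrite (fsbigE [:: 0%N]) // => [|i _].
  by rewrite big_cons big_nil mem_setT /= addr0.
by rewrite inE -lt0n => /F0.
Qed.

Lemma derive_eq_on (R : numFieldType) (V W : normedModType R)
    (f g : V -> W) (A : set V) (x v : V) :
  open A -> A x -> {in A, f =1 g} -> 'D_v f x = 'D_v g x.
Proof.
move=> oA Ax fg; apply: near_eq_derive.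
by apply: filterS (open_nbhs_nbhs (conj oA Ax)) => y Ay; apply: fg; rewrite inE.
Qed.

(** * Variational derivatives and brackets of order-zero densities *)

Section OrderZeroDensities.
Context {R : realType} {N : nat}.
Implicit Types (phi psi : 'rV[R]_N -> R) (J : @jet R N).

Lemma jet_partial_order0 i phi :
  jet_partial 0 i (order0_density phi) = order0_density (partial i phi).
Proof.
apply/funext => J; rewrite /jet_partial /order0_density /partial /derive1 /derive.
set f := fun h : R => _; set g := fun h : R => _.
suff -> : f = g by [].
rewrite /f /g; apply/funext => h.
by rewrite /shift_jet /= addr0 scale0r addr0 [h *: _ + _]addrC.
Qed.

Lemma jet_partial_order0S k i phi :
  jet_partial k.+1 i (order0_density phi) = cst 0.
Proof.
apply/funext => J; rewrite /jet_partial /order0_density /shift_jet /=.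
exact: (derive1_cst (phi (J 0%N) : R^o)).
Qed.

Lemma total_derivative0 : total_derivative (cst 0) = cst 0 :> (@jet R N -> R).
Proof.
apply/funext => J; rewrite /total_derivative fsbig1 // => k _.
by rewrite big1 // => i _; rewrite /jet_partial derive1_cst mulr0.
Qed.

Lemma total_derivative_order0 phi J :
  total_derivative (order0_density phi) J =
  \sum_(i < N) J 1%N 0 i * partial i phi (J 0%N).
Proof.
rewrite /total_derivative fsum_nat_only0; last first.
  by case=> // k _; rewrite big1 // => i _; rewrite jet_partial_order0S mulr0.
by apply: eq_bigr => i _; rewrite jet_partial_order0.
Qed.

Lemma variational_derivative_order0 i phi :
  variational_derivative i (order0_density phi) = order0_density (partial i phi).
Proof.
apply/funext => J; rewrite /variational_derivative fsum_nat_only0; last first.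
  case=> // k _; rewrite jet_partial_order0S.
  suff -> : iter k.+1 total_derivative (cst 0) = cst 0 :> (@jet R N -> R).
    by rewrite mulr0.
  by elim: k.+1 => //= n ->; rewrite total_derivative0.
by rewrite /= expr0 mul1r jet_partial_order0.
Qed.

Definition bracket_form (eta : 'M[R]_N) phi psi (l : 'I_N) : 'rV[R]_N -> R :=
  fun u => \sum_(i < N) \sum_(j < N)
    eta i j * (partial i phi u * partial l (partial j psi) u).

Lemma poisson_bracket_order0 (eta : 'M[R]_N) phi psi J :
  poisson_bracket eta (order0_density phi) (order0_density psi) J =
  \sum_(l < N) J 1%N 0 l * bracket_form eta phi psi l (J 0%N).
Proof.
rewrite /poisson_bracket /bracket_form.
under eq_bigr => i _ do under eq_bigr => j _ do
  rewrite !variational_derivative_order0 total_derivative_order0 /order0_density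
    !mulr_sumr.
under [RHS]eq_bigr => l _ do
  (rewrite mulr_sumr; under eq_bigr => i _ do rewrite mulr_sumr).
(* The index [l] of the total derivative is innermost on the left and outermost on the right; two
   interchanges move it inward. *)
rewrite [RHS]exchange_big /=; apply: eq_bigr => i _.
rewrite [RHS]exchange_big /=; apply: eq_bigr => j _.
by apply: eq_bigr => l _; rewrite mulrCA [RHS]mulrCA; congr (_ * _); rewrite mulrCA.
Qed.

End OrderZeroDensities.

(** * Frechet differentiability from a linear approximation *)

Section DifferentiabilityCriterion.
Context {R : realType} {V W : normedModType R}.
Implicit Types (f g : V -> W) (x : V).

(** The estimate is the little-o expansion with linear part [L]. By uniqueness of the differential,
    ['d f x] is then [L] itself, which gives both conclusions. *)
Lemma differentiable_approx f (L : {linear V -> W}) x : continuous L ->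
  (forall e : R, 0 < e ->
    \forall h \near 0, `|f (h + x) - f x - L h| <= e * `|h|) ->
  differentiable f x /\ forall v, 'D_v f x = L v.
Proof.
move=> Lc Lf.
have fE : f \o shift x = cst (f x) + L +o_ 0 id.
  apply/eqaddoP => e e0; near=> h.
  by rewrite /= /GRing.add /GRing.opp /= opprD addrA; near: h; exact: Lf.
have dfL := diff_unique Lc fE.
have df : differentiable f x by apply/diff_locallyP; rewrite dfL.
by split=> // v; rewrite deriveE // dfL.
Unshelve. all: by end_near. Qed.

Lemma differentiable_near_eq f g x :
  (\forall y \near x, f y = g y) -> differentiable f x -> differentiable g x.
Proof.
move=> fg df; apply: (proj1 (differentiable_approx (diff_continuous df) _)) => e e0.
have fgx := nbhs_singleton fg.
have /diff_locally := df; move=> /eqaddoP /(_ e e0).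
have fgs : \forall h \near 0, f (h + x) = g (h + x).
  by move: fg; rewrite (near_shift 0) /=; apply: filterS => h; rewrite subr0.
apply: filterS2 fgs => h fgh.
by rewrite /= /GRing.add /GRing.opp /= opprD addrA fgh fgx.
Qed.

End DifferentiabilityCriterion.

(** * Closure properties of smooth functions *)

Section Smoothness.
Context {R : realType} {V : normedModType R}.
Implicit Types (A B : set V) (f g : V -> R) (v x : V).

(** Smoothness graded by order. The Leibniz rule mixes a function with its derivatives, so closure
    under products is proved by induction on this order rather than on a list of directions. *)
Fixpoint differentiable_upto (n : nat) A f : Prop :=
  (forall x, A x -> differentiable f x) /\
  (if n is m.+1 then forall v, differentiable_upto m A ('D_v f) else True).

Lemma smooth_on_derive A f v : smooth_on A f -> smooth_on A ('D_v f).
Proof. by move=> sf vs x Ax; have := sf (rcons vs v) x Ax; rewrite foldr_rcons. Qed.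

Lemma smooth_on_differentiable A f x : smooth_on A f -> A x -> differentiable f x.
Proof. by move=> sf Ax; exact: (sf [::] x Ax). Qed.

Lemma smooth_onP A f : smooth_on A f <-> forall n, differentiable_upto n A f.
Proof.
split=> [sf n|df vs].
  elim: n f sf => [|n IHn] f sf; split=> //.
  - by move=> x; exact: smooth_on_differentiable.
  - by move=> x; exact: smooth_on_differentiable.
  - by move=> v; apply/IHn/smooth_on_derive.
(* The last entry of the list is the derivative taken first, so induction from the right replaces
   [f] by ['D_v f]. *)
elim/last_ind: vs f df => [|vs v IHvs] f df x Ax; first exact: (df 0%N).1.
by rewrite foldr_rcons; apply: IHvs => // n; exact: (df n.+1).2.
Qed.

Lemma differentiable_upto_le m n A f : (m <= n)%N ->
  differentiable_upto n A f -> differentiable_upto m A f.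
Proof.
elim: n m f => [[]//|n IHn] [|m] f; first by move=> _ [df _].
by rewrite ltnS => lemn [df dDf]; split=> // v; exact: IHn lemn (dDf v).
Qed.

Lemma differentiable_upto_eq n A f g : open A -> (forall x, A x -> f x = g x) ->
  differentiable_upto n A f -> differentiable_upto n A g.
Proof.
move=> oA; elim: n f g => [|n IHn] f g fg [df dDf]; split=> //.
- move=> x Ax; apply: differentiable_near_eq (df x Ax).
  by apply: filterS (open_nbhs_nbhs (conj oA Ax)).
- move=> x Ax; apply: differentiable_near_eq (df x Ax).
  by apply: filterS (open_nbhs_nbhs (conj oA Ax)).
- move=> v; apply: IHn (dDf v) => x Ax.
  by apply: (derive_eq_on v oA Ax) => y; rewrite inE => /fg.
Qed.

Lemma differentiable_uptoD n A f g : open A ->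
  differentiable_upto n A f -> differentiable_upto n A g ->
  differentiable_upto n A (f + g).
Proof.
move=> oA; elim: n f g => [|n IHn] f g [df dDf] [dg dDg]; split=> //.
- by move=> x Ax; apply: differentiableD; [exact: df|exact: dg].
- by move=> x Ax; apply: differentiableD; [exact: df|exact: dg].
- move=> v; apply: differentiable_upto_eq (IHn _ _ (dDf v) (dDg v)) => // x Ax.
  by rewrite deriveD //; apply: diff_derivable; [exact: df|exact: dg].
Qed.

Lemma differentiable_uptoM n A f g : open A ->
  differentiable_upto n A f -> differentiable_upto n A g ->
  differentiable_upto n A (f * g).
Proof.
move=> oA; elim: n f g => [|n IHn] f g sf sg.
  by split=> // x Ax; apply: differentiableM; [exact: sf.1|exact: sg.1].
have [df dDf] := sf; have [dg dDg] := sg; split=> [x Ax|v].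
  by apply: differentiableM; [exact: df|exact: dg].
(* In [f * 'D_v g + g * 'D_v f] the undifferentiated factors have one order to spare; lowering it
   makes the induction hypothesis applicable. *)
have sf' := differentiable_upto_le (leqnSn n) sf.
have sg' := differentiable_upto_le (leqnSn n) sg.
apply: differentiable_upto_eq (differentiable_uptoD oA
  (IHn _ _ sf' (dDg v)) (IHn _ _ sg' (dDf v))) => // x Ax.
by rewrite deriveM //; apply: diff_derivable; [exact: df|exact: dg].
Qed.

Lemma differentiable_upto_cst n A (c : R) : differentiable_upto n A (cst c).
Proof.
elim: n c => [|n IHn] c; split=> // v.
have -> : 'D_v (cst c) = cst 0 :> (V -> R) by apply/funext => x; exact: derive_cst.
exact: IHn.
Qed.

Lemma smooth_on_eq A f g : open A -> (forall x, A x -> f x = g x) ->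
  smooth_on A f -> smooth_on A g.
Proof.
move=> oA fg /smooth_onP sf; apply/smooth_onP => n.
exact: differentiable_upto_eq (sf n).
Qed.

Lemma smooth_onD A f g : open A ->
  smooth_on A f -> smooth_on A g -> smooth_on A (f + g).
Proof.
move=> oA /smooth_onP sf /smooth_onP sg; apply/smooth_onP => n.
exact: differentiable_uptoD.
Qed.

Lemma smooth_onM A f g : open A ->
  smooth_on A f -> smooth_on A g -> smooth_on A (f * g).
Proof.
move=> oA /smooth_onP sf /smooth_onP sg; apply/smooth_onP => n.
exact: differentiable_uptoM.
Qed.

Lemma smooth_on_cst A (c : R) : smooth_on A (cst c).
Proof. by apply/smooth_onP => n; exact: differentiable_upto_cst. Qed.

Lemma smooth_on_sum A (I : finType) (F : I -> V -> R) : open A ->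
  (forall i, smooth_on A (F i)) -> smooth_on A (fun x => \sum_i F i x).
Proof.
move=> oA sF.
have -> : (fun x => \sum_i F i x) = \sum_i F i.
  by apply/funext => x; rewrite fct_sumE.
elim/big_ind : _ => [|f g|i _]; [exact: smooth_on_cst|exact: smooth_onD|exact: sF].
Qed.

Lemma smooth_on_coinduction A f :
  (forall x, A x -> differentiable f x) -> (forall v, smooth_on A ('D_v f)) ->
  smooth_on A f.
Proof.
move=> df sDf vs; elim/last_ind: vs => [|vs v _] x Ax; first exact: df.
by rewrite foldr_rcons; exact: sDf.
Qed.

Lemma smooth_on_sub A B f : B `<=` A -> smooth_on A f -> smooth_on B f.
Proof. by move=> BA sf vs x /BA; exact: sf. Qed.

Lemma smooth_on_continuous A f x : smooth_on A f -> A x -> {for x, continuous f}.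
Proof. by move=> sf Ax; exact/differentiable_continuous/(smooth_on_differentiable sf). Qed.

End Smoothness.

(** * Mean value theorem on lines and symmetry of second derivatives *)

Section MeanValueSchwarz.
Context {R : realType} {V : normedModType R}.
Implicit Types (A : set V) (f g : V -> R) (x v w : V).

(** Both difference quotients are the same function of the increment, so no chain rule is
    involved. *)
Lemma is_derive_line f x v (s : R) : derivable f (x + s *: v) v ->
  is_derive s 1 (fun t : R => f (x + t *: v)) ('D_v f (x + s *: v)).
Proof.
have E : (fun h : R => h^-1 *: (((fun t : R => f (x + t *: v)) \o shift s) (h *: 1)
      - f (x + s *: v)))
    = (fun h => h^-1 *: ((f \o shift (x + s *: v)) (h *: v) - f (x + s *: v))).
  apply/funext => h /=.
  by rewrite [h *: 1]mulr1 scalerDl addrCA.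
by move=> df; split; rewrite /derivable /derive E.
Qed.

Lemma derivable_MVT (f df : R -> R) (a b : R) : a < b ->
  (forall t, a <= t <= b -> is_derive t 1 f (df t)) ->
  exists2 c, a < c < b & f b - f a = df c * (b - a).
Proof.
move=> ab fdf; have [||c cab ->] := @MVT _ f df a b ab.
- by move=> t; rewrite in_itv /= => /andP[/ltW at_ /ltW tb]; apply: fdf; rewrite at_.
- apply: derivable_within_continuous => t; rewrite in_itv /= => /fdf df_.
  exact: ex_derive.
- by exists c.
Qed.

Lemma MVT_line f x v (t : R) : 0 < t ->
  (forall s, 0 <= s <= t -> derivable f (x + s *: v) v) ->
  exists2 s, 0 < s < t & f (x + t *: v) - f x = 'D_v f (x + s *: v) * t.
Proof.
move=> t0 df; have [s /df|s s0t E] := derivable_MVT (f := fun s => f (x + s *: v))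
    (df := fun s => 'D_v f (x + s *: v)) t0; first exact: is_derive_line.
by exists s => //; rewrite scale0r addr0 subr0 in E.
Qed.

(** Two mean value theorems: first along [v] for the difference of [f] on two parallel segments a
    step [t *: w] apart, then along [w] for ['D_v f]. *)
Lemma second_difference A f x v w (t : R) : 0 < t -> smooth_on A f ->
  (forall s r : R, 0 <= s <= t -> 0 <= r <= t -> A (x + s *: v + r *: w)) ->
  exists s r : R, [/\ 0 < s < t, 0 < r < t &
    f (x + t *: v + t *: w) - f (x + t *: v) - (f (x + t *: w) - f x)
    = 'D_w ('D_v f) (x + s *: v + r *: w) * (t * t)].
Proof.
move=> t0 sf Axvw; have t0' : 0 <= (0 : R) <= t by rewrite lexx ltW.
have tt : 0 <= t <= t by rewrite ltW /=.
have [s st|s s0t] := derivable_MVT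
    (f := (fun s => f (x + t *: w + s *: v)) - (fun s => f (x + s *: v)))
    (df := (fun s => 'D_v f (x + t *: w + s *: v)) - (fun s => 'D_v f (x + s *: v))) t0.
  apply: is_deriveB; apply/is_derive_line/diff_derivable;
    apply: (smooth_on_differentiable sf).
    by rewrite addrAC; exact: Axvw.
  by have := Axvw s 0 st t0'; rewrite scale0r addr0.
rewrite subr0 !fctE !scale0r !addr0 => E.
have st : 0 <= s <= t by case/andP: s0t => /ltW -> /ltW ->.
have [r r0t|r r0t E'] := MVT_line (f := 'D_v f) (x := x + s *: v) (v := w) t0.
  exact/diff_derivable/(smooth_on_differentiable (smooth_on_derive v sf))/Axvw.
exists s, r; split=> //; rewrite mulrA -E' [x + s *: v + _]addrAC -E.
by rewrite [x + _ + _]addrAC.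
Qed.

Lemma near_dist_lt (g : V -> R) x (e : R) : {for x, continuous g} -> 0 < e ->
  \forall y \near x, `|g x - g y| < e.
Proof. by move=> /cvgrPdist_lt gx e0; exact: gx. Qed.

(** Schwarz's theorem. The second difference over a small parallelogram is symmetric in [v] and [w],
    and equals [t * t] times either mixed derivative at some point close to [x]; continuity of both
    mixed derivatives finishes. *)
Lemma derive_swap A f x v w : open A -> smooth_on A f -> A x ->
  'D_w ('D_v f) x = 'D_v ('D_w f) x.
Proof.
move=> oA sf Ax.
pose P : V -> R := 'D_w ('D_v f); pose Q : V -> R := 'D_v ('D_w f).
suff PQ (e : R) : 0 < e -> `|P x - Q x| <= e.
  by apply/eqP; rewrite -[_ == _]subr_eq0 -normr_le0; apply/ler_addgt0Pr => e e0; rewrite add0r PQ.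
move=> e0; have e20 : 0 < e / 2 by rewrite divr_gt0.
have nA : nbhs x A by exact: open_nbhs_nbhs.
have nP : \forall y \near x, `|P x - P y| < e / 2.
  apply: near_dist_lt e20.
  exact: smooth_on_continuous (smooth_on_derive w (smooth_on_derive v sf)) Ax.
have nQ : \forall y \near x, `|Q x - Q y| < e / 2.
  apply: near_dist_lt e20.
  exact: smooth_on_continuous (smooth_on_derive v (smooth_on_derive w sf)) Ax.
have nAPQ : \forall y \near x,
    [/\ A y, `|P x - P y| < e / 2 & `|Q x - Q y| < e / 2].
  by apply: filterS2 nA (filterI nP nQ) => y Ay [Py Qy].
have /nbhs_ballP[d /= d0 dAPQ] := nAPQ.
have dA y : ball x d y -> A y by case/dAPQ.
(* The size of [t] keeps the parallelogram inside the ball of radius [d]; the summand 1 keeps the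
   denominator positive when [v] and [w] are zero. *)
pose t := d / 2 / (`|v| + `|w| + 1).
have vw1 : 0 < `|v| + `|w| + 1 by rewrite ltr_wpDl // addr_ge0.
have t0 : 0 < t by rewrite !divr_gt0.
have inball s r : 0 <= s <= t -> 0 <= r <= t -> ball x d (x + s *: v + r *: w).
  move=> /andP[s0 st] /andP[r0 rt]; rewrite -ball_normE /ball_ /=.
  rewrite -addrA opprD addrA subrr add0r normrN.
  apply: le_lt_trans (ler_normD _ _) _; rewrite !normrZ !ger0_norm //.
  apply: (@le_lt_trans _ _ (t * (`|v| + `|w| + 1))).
    rewrite !mulrDr mulr1 -[leLHS]addr0.
    by apply: lerD; [apply: lerD; exact: ler_wpM2r | exact: ltW].
  by rewrite divfK ?gt_eqF // ltr_pdivrMr // ltr_pMr // ltr1n.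
have weak (c : R) : 0 < c < t -> 0 <= c <= t by case/andP=> /ltW -> /ltW ->.
have [s [r [/weak s0t /weak r0t E]]] :
    exists s r : R, [/\ 0 < s < t, 0 < r < t &
    f (x + t *: v + t *: w) - f (x + t *: v) - (f (x + t *: w) - f x)
    = P (x + s *: v + r *: w) * (t * t)].
  apply: second_difference (t0) sf _ => s r st rt.
  exact/dA/inball.
have [r' [s' [/weak r0t' /weak s0t' E']]] :
    exists r' s' : R, [/\ 0 < r' < t, 0 < s' < t &
    f (x + t *: w + t *: v) - f (x + t *: w) - (f (x + t *: v) - f x)
    = Q (x + r' *: w + s' *: v) * (t * t)].
  apply: second_difference (t0) sf _ => r1 s1 rt st.
  by rewrite addrAC; apply/dA/inball.
have [_ Pe _] := dAPQ _ (inball _ _ s0t r0t).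
have [_ _ Qe] := dAPQ _ (inball _ _ s0t' r0t').
move: E E' Pe Qe; clearbody P Q.
rewrite [x + t *: w + _]addrAC [x + r' *: w + _]addrAC.
move: (P x) (P _) (Q x) (Q _) (f _) (f _) (f _) (f _) => p p' q q' a b c c'.
(* The two second differences differ only in the order of the middle terms; cancelling [t * t] then
   equates the mixed derivatives at the two intermediate points. *)
have <- : c' - c - (b - a) = c' - b - (c - a).
  by rewrite !opprB addrACA [RHS]addrACA [- b + _]addrC.
move=> ->; have tt0 : t * t != 0 by rewrite mulf_neq0 // gt_eqF.
move=> /(mulIf tt0) -> pe qe; rewrite -(subrKA q') [leRHS]splitr.
apply: le_trans (ler_normD _ _) _; rewrite [X in _ + X <= _]distrC.
by apply: lerD; exact: ltW.
Qed.

End MeanValueSchwarz.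

(** The integral from [a], by the fundamental theorem of calculus. Two-sided differentiability is
    obtained at interior points only. *)
Lemma continuous_antiderivative (R : realType) (f : R -> R) (a b : R) :
  (forall t, a <= t <= b -> {for t, continuous f}) ->
  exists F : R -> R, forall t, a < t < b -> is_derive t 1 F (f t).
Proof.
move=> fc; pose mu := @lebesgue_measure R.
have fi : mu.-integrable `[a, b] (EFin \o f).
  apply: continuous_compact_integrable; first exact: segment_compact.
  apply: continuous_in_subspaceT => t; rewrite inE /= in_itv /=.
  exact: fc.
exists (fun x => (\int[mu]_(t in [set` `[a, x]]) f t)%R) => t /andP[at_ tb].
have [|dF F't] := continuous_FTC1_closed tb fi at_ _.
  by apply: fc; rewrite !ltW.
by split=> //; rewrite -derive1E.
Qed.

(** * Partial derivatives and local bounds on directional derivatives *)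

Section RowVectors.
Context {R : realType} {N : nat}.
Implicit Types (f : 'rV[R]_N -> R) (x v w u : 'rV[R]_N) (U : set 'rV[R]_N).

Lemma ler_coord_norm v l : `|v 0 l| <= `|v|.
Proof.
rewrite [leRHS]/Num.Def.normr/= mx_normrE.
exact: (le_bigmax _ (fun i : 'I_1 * 'I_N => `|v i.1 i.2|) (0, l)).
Qed.

Lemma derive_partial f x v : differentiable f x ->
  'D_v f x = \sum_(i < N) v 0 i * partial i f x.
Proof.
move=> df; rewrite deriveE // [in LHS](row_sum_delta v) linear_sum.
by apply: eq_bigr => i _; rewrite linearZ /partial deriveE.
Qed.

Lemma smooth_on_partial U f i : smooth_on U f -> smooth_on U (partial i f).
Proof. exact: smooth_on_derive. Qed.

Lemma partial_swap U f i j u : open U -> smooth_on U f -> U u ->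
  partial i (partial j f) u = partial j (partial i f) u.
Proof. exact: derive_swap. Qed.

(** By continuity, near [u] each partial derivative exceeds its value at [u] by at most 1 in
    modulus; summing gives a constant independent of [v]. *)
Lemma derive_bound U f u : open U -> smooth_on U f -> U u ->
  exists2 C, 0 <= C & \forall y \near u, forall v, `|'D_v f y| <= C * `|v|.
Proof.
move=> oU sf Uu; exists (\sum_(i < N) (`|partial i f u| + 1)).
  by apply: sumr_ge0 => i _; rewrite addr_ge0.
have nU : nbhs u U by exact: open_nbhs_nbhs.
have nf i : \forall y \near u, `|partial i f u - partial i f y| < 1.
  apply: near_dist_lt ltr01.
  exact: smooth_on_continuous (smooth_on_partial i sf) Uu.
apply: filterS2 nU (filter_forall _ nf) => y Uy fy v.
rewrite derive_partial; last exact: smooth_on_differentiable sf Uy.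
rewrite mulr_suml; apply: le_trans (ler_norm_sum _ _ _) _; apply: ler_sum => i _.
rewrite normrM mulrC ler_pM ?ler_coord_norm //.
rewrite -lerBlDl; apply: le_trans (lerB_dist _ _) _.
by rewrite distrC ltW.
Qed.

(** Expanding the outer derivative in coordinates and swapping leaves ['D_v] of the fixed functions
    [partial i f], to which the first-order bound applies uniformly in [v]. *)
Lemma derive2_bound U f u : open U -> smooth_on U f -> U u ->
  exists2 C, 0 <= C &
    \forall y \near u, forall v, `|'D_v ('D_v f) y| <= C * (`|v| * `|v|).
Proof.
move=> oU sf Uu.
have /fin_all_exists2[C C0 fC] i := derive_bound oU (smooth_on_partial i sf) Uu.
exists (\sum_i C i); first by apply: sumr_ge0 => i _; exact: C0.
have nU : nbhs u U by exact: open_nbhs_nbhs.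
apply: filterS2 nU (filter_forall _ fC) => y Uy fy v.
rewrite derive_partial; last first.
  exact: smooth_on_differentiable (smooth_on_derive v sf) Uy.
rewrite mulr_suml; apply: le_trans (ler_norm_sum _ _ _) _; apply: ler_sum => i _.
rewrite normrM /partial (derive_swap _ _ oU sf Uy) mulrCA.
by rewrite ler_pM ?ler_coord_norm //; exact: fy.
Qed.

End RowVectors.

(** * Closed 1-forms and their contractions *)

Section ClosedForms.
Context {R : realType} {N : nat}.
Implicit Types (A : 'I_N -> 'rV[R]_N -> R) (x y v w u z : 'rV[R]_N).
Implicit Types U : set 'rV[R]_N.

(** Contraction of the 1-form [A] with the constant vector field [v], a function of the base point,
    so that it can be differentiated in other directions. *)
Definition pairing A v : 'rV[R]_N -> R := fun z => \sum_(l < N) v 0 l * A l z.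

Lemma pairing_linear A z : linear (pairing A ^~ z).
Proof.
move=> a v w; rewrite /pairing scaler_sumr -big_split; apply: eq_bigr => l _ /=.
by rewrite !mxE mulrDl -mulrA.
Qed.

Lemma pairingD A v w z : pairing A (v + w) z = pairing A v z + pairing A w z.
Proof. by have := pairing_linear A z 1 v w; rewrite /= !scale1r. Qed.

Lemma pairing_delta A l z : pairing A (delta_mx 0 l) z = A l z.
Proof.
rewrite /pairing (bigD1 l) //= mxE !eqxx mul1r big1 ?addr0 // => k kl.
by rewrite mxE eqxx (negPf kl) mul0r.
Qed.

Lemma smooth_on_pairing U A v : open U -> (forall l, smooth_on U (A l)) ->
  smooth_on U (pairing A v).
Proof.
move=> oU sA; apply: smooth_on_sum => // l.
by apply: (@smooth_onM _ _ U (cst (v 0 l)) (A l)) => //; exact: smooth_on_cst.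
Qed.

Lemma derive_pairing A v w z : (forall l, differentiable (A l) z) ->
  'D_w (pairing A v) z = pairing (fun l => 'D_w (A l)) v z.
Proof.
move=> dA; have -> : pairing A v = \sum_(l < N) (v 0 l \*: A l).
  by apply/funext => y; rewrite fct_sumE.
rewrite derive_sum => [|l]; last exact/derivableZ/diff_derivable.
by apply: eq_bigr => l _; rewrite deriveZ //; exact: diff_derivable.
Qed.

Lemma ler_norm_pairing (B : 'I_N -> R) (C : 'I_N -> R) v (c : R) : 0 <= c ->
  (forall l, `|B l| <= C l * c) ->
  `|\sum_l v 0 l * B l| <= (\sum_l C l) * (`|v| * c).
Proof.
move=> c0 BC; apply: le_trans (ler_norm_sum _ _ _) _.
rewrite mulr_suml; apply: ler_sum => l _.
by rewrite normrM mulrCA ler_pM ?ler_coord_norm.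
Qed.

(** One constant serves first and second derivatives of all contractions; these bounds control the
    remainder in the quadratic estimate for the primitive. *)
Lemma pairing_bounds U A u : open U -> (forall l, smooth_on U (A l)) -> U u ->
  exists2 C, 0 <= C & \forall y \near u, forall v w,
    `|'D_w (pairing A v) y| <= C * (`|v| * `|w|) /\
    `|'D_w ('D_w (pairing A v)) y| <= C * (`|v| * (`|w| * `|w|)).
Proof.
move=> oU sA Uu.
have /fin_all_exists2[C C0 AC] l := derive_bound oU (sA l) Uu.
have /fin_all_exists2[D D0 AD] l := derive2_bound oU (sA l) Uu.
have C0' : 0 <= \sum_l C l by apply: sumr_ge0 => l _; exact: C0.
have D0' : 0 <= \sum_l D l by apply: sumr_ge0 => l _; exact: D0.
exists (\sum_l C l + \sum_l D l); first exact: addr_ge0.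
have nU : nbhs u U by exact: open_nbhs_nbhs.
apply: filterS2 nU (filterI (filter_forall _ AC) (filter_forall _ AD)).
move=> y Uy [ACy ADy] v w.
have E z : U z -> 'D_w (pairing A v) z = pairing (fun l => 'D_w (A l)) v z.
  by move=> Uz; apply: derive_pairing => l; exact: smooth_on_differentiable (sA l) Uz.
split.
  rewrite E //; apply: le_trans (ler_norm_pairing _ _ (fun l => ACy l w)) _ => //.
  by rewrite ler_wpM2r ?mulr_ge0 // lerDl.
rewrite (derive_eq_on (A := U) (g := pairing (fun l => 'D_w (A l)) v)) //;
  last by move=> z; rewrite inE => /E.
rewrite derive_pairing => [|l]; last first.
  exact: smooth_on_differentiable (smooth_on_derive w (sA l)) Uy.
apply: le_trans (ler_norm_pairing _ _ (fun l => ADy l w)) _; first exact: mulr_ge0.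
by rewrite ler_wpM2r ?mulr_ge0 // lerDr.
Qed.

Definition closed_on U A := forall (k l : 'I_N) u, U u ->
  partial k (A l) u = partial l (A k) u.

(** Closedness tested on two constant vector fields: both sides expand bilinearly in [v] and [w]. *)
Lemma closed_on_derive U A v w u : (forall l, smooth_on U (A l)) ->
  closed_on U A -> U u -> 'D_w (pairing A v) u = 'D_v (pairing A w) u.
Proof.
move=> sA cA Uu; have dA l := smooth_on_differentiable (sA l) Uu.
rewrite !derive_pairing // /pairing.
under eq_bigr => l _ do rewrite derive_partial // mulr_sumr.
rewrite exchange_big; apply: eq_bigr => k _ /=.
rewrite derive_partial // mulr_sumr; apply: eq_bigr => l _.
by rewrite cA // mulrCA.
Qed.

End ClosedForms.

(** * Poincare lemma: a primitive by integration along rays *)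

Section PoincareLemma.
Context {R : realType} {N : nat}.
Implicit Types (A : 'I_N -> 'rV[R]_N -> R) (x y v w u z : 'rV[R]_N).
Implicit Types U : set 'rV[R]_N.

Lemma ball_convex2 (u x y : 'rV[R]_N) (r a b : R) :
  0 <= a -> 0 <= b -> a + b <= 1 -> ball u r x -> ball u r y ->
  ball u r (u + a *: (x - u) + b *: (y - u)).
Proof.
rewrite -!ball_normE /ball_ /= => a0 b0 ab1 xr yr.
have r0 : 0 < r by apply: le_lt_trans xr.
rewrite -addrA opprD addrA subrr add0r normrN.
apply: le_lt_trans (ler_normD _ _) _; rewrite !normrZ !ger0_norm // !(distrC _ u).
(* Strictness must come from a term of positive weight; when [a = 0] the bound on [y] alone supplies
   it. *)
have [a1|a1] := ltrP 0 a.
  apply: (@lt_le_trans _ _ (a * r + b * r)); last by rewrite -mulrDl ler_piMl // ltW.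
  by rewrite ltr_leD ?ltr_pM2l // ler_wpM2l // ltW.
have -> : a = 0 by apply/le_anti; rewrite a1.
rewrite mul0r add0r; apply: le_lt_trans yr.
by rewrite ler_piMl //; apply: le_trans ab1; rewrite lerDr.
Qed.

(** The parameter range exceeds [[0, 1]] on both sides, so that an antiderivative along the ray is
    differentiable at 0 and 1 too. *)
Lemma ball_ray (u x : 'rV[R]_N) (r t : R) : -2 <= t <= 2 -> ball u r x ->
  ball u (2 * r) (u + t *: (x - u)).
Proof.
move=> t2; rewrite -!ball_normE /ball_ /= => xr.
rewrite opprD addrA subrr add0r normrN normrZ distrC.
have t2' : `|t| <= 2 by rewrite ler_norml.
apply: (@le_lt_trans _ _ (2 * `|u - x|)); first exact: ler_wpM2r.
by rewrite ltr_pM2l.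
Qed.

Section Primitive.
Variables (U : set 'rV[R]_N) (A : 'I_N -> 'rV[R]_N -> R) (u : 'rV[R]_N) (r C : R).
Hypotheses (oU : open U) (sA : forall l, smooth_on U (A l)) (cA : closed_on U A).
Hypotheses (C0 : 0 <= C) (rU : ball u (2 * r) `<=` U).
Hypothesis bA : forall z, ball u r z -> forall v w,
  `|'D_w (pairing A v) z| <= C * (`|v| * `|w|) /\
  `|'D_w ('D_w (pairing A v)) z| <= C * (`|v| * (`|w| * `|w|)).

Let ballU z : ball u r z -> U z.
Proof.
move=> zr; have := ball_ray (t := 1) _ zr; rewrite scale1r addrC subrK.
by move=> H; apply/rU/H; rewrite ler1n andbT; apply: le_trans ler01; rewrite oppr_le0.
Qed.

Let B v := pairing A v.
Let sB v : smooth_on U (B v). Proof. exact: smooth_on_pairing. Qed.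

Lemma radial_antiderivative x : ball u r x ->
  exists F : R -> R, forall t : R, 0 <= t <= 1 ->
    is_derive t 1 F (B (x - u) (u + t *: (x - u))).
Proof.
move=> xr.
pose f (t : R) := B (x - u) (u + t *: (x - u)).
have fc (t : R) : -2 <= t <= 2 -> {for t, continuous f}.
  move=> t2; have Ut : U (u + t *: (x - u)) by apply/rU/ball_ray.
  have := smooth_on_differentiable (sB (x - u)) Ut.
  move=> /(@diff_derivable _ _ _ _ _ (x - u)) /is_derive_line[df _].
  exact/differentiable_continuous/derivable1_diffP.
have [F FP] := continuous_antiderivative fc.
exists F => t /andP[t0 t1]; apply: FP.
rewrite (lt_le_trans _ t0) ?oppr_lt0 // (le_lt_trans t1) //.
by rewrite ltr1n.
Qed.

Variable F : 'rV[R]_N -> R -> R.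
Hypothesis FP : forall x, ball u r x -> forall t : R, 0 <= t <= 1 ->
  is_derive t 1 (F x) (B (x - u) (u + t *: (x - u))).

(** The integral of [A] along the segment from [u] to [x]; taking the increment makes it independent
    of the additive constant in [F x]. *)
Definition primitive x := F x 1 - F x 0.

(* Mean value theorem for t |-> F_y(t) - F_x(t) - t B_w(u + t (x - u)), where
   B_v = pairing A v and w = y - x: closedness turns the term D_(x-u) B_w of
   its derivative into D_w B_(x-u), and what remains is the second-order Taylor
   remainder of B_(y-u) along w plus t D_w B_w. *)
Lemma primitive_approx x y : ball u r x -> ball u r y ->
  `|primitive y - primitive x - pairing A (y - x) x|
    <= C * (r + 1) * (`|y - x| * `|y - x|).
Proof.
move=> xr yr; set w := y - x; set x' := x - u; set y' := y - u.
have y'E : y' = x' + w by rewrite /y' /w /x' [RHS]addrC subrKA.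
pose c (t : R) := u + t *: x'.
(* These points fill the triangle with vertices [u], [x], [y], where all estimates take place. *)
have cr (t s : R) : 0 <= t <= 1 -> 0 <= s <= t -> ball u r (c t + s *: w).
  move=> /andP[t0 t1] /andP[s0 st].
  have -> : c t + s *: w = u + (t - s) *: (x - u) + s *: (y - u).
    rewrite /c -!addrA; congr (_ + _).
    by rewrite -/x' -/y' y'E scalerBl [s *: (x' + w)]scalerDr subrKA.
  by apply: ball_convex2 => //; rewrite ?subr_ge0 ?subrK.
have [t t01|t t01] := @derivable_MVT R
  (F y - F x - (fun t => t) * (fun t => B w (c t)))
  (fun t => B y' (u + t *: y') - B x' (c t) - (t *: 'D_x' (B w) (c t) + B w (c t) *: 1))
  0 1 ltr01.
  have ct : U (c t).
    by have := cr t 0 t01; rewrite scale0r addr0 => H; apply/ballU/H; rewrite lexx /=; case/andP: t01.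
  apply: is_deriveB.
    by apply: is_deriveB; exact: FP.
  apply: is_deriveM; apply: (@is_derive_line _ _ (B w) u x' t).
  by apply: diff_derivable; exact: smooth_on_differentiable (sB w) ct.
rewrite !fctE mul0r mul1r !subr0 mulr1 {1}/c scale1r [u + x']addrC subrK.
rewrite [_%:A]mulr1 => E.
have {E} -> : primitive y - primitive x - pairing A w x =
    B y' (u + t *: y') - B x' (c t) - (t * 'D_x' (B w) (c t) + B w (c t)).
  rewrite -E /primitive -/(B w); move: (F y 1) (F x 1) (F y 0) (F x 0) (B w x).
  by move=> a b a' b' d; ring.
have yE : u + t *: y' = c t + t *: w by rewrite y'E scalerDr addrA.
have t0 : 0 < t by case/andP: t01.
have t1 : t <= 1 by case/andP: t01 => _ /ltW.
have t01' : 0 <= t <= 1 by rewrite ltW.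
have tr (s : R) : 0 <= s <= t -> ball u r (c t + s *: w) by exact: cr.
have ctr : ball u r (c t) by have := tr 0; rewrite scale0r addr0 lexx ltW //; exact.
(* Taylor expansion of [B y'] along [w] from [c t], as two nested mean value theorems: the second is
   applied to the derivative that the first produces. *)
have [s st|s /andP[s0 st] Es] := MVT_line (f := B y') (x := c t) (v := w) t0.
  by apply/diff_derivable/(smooth_on_differentiable (sB y'))/ballU/tr.
have [s1 s1s|s1 /andP[s10 s1s] Es1] :=
  MVT_line (f := 'D_w (B y')) (x := c t) (v := w) s0.
  apply/diff_derivable/(smooth_on_differentiable (smooth_on_derive w (sB y'))).
  by apply/ballU/tr; case/andP: s1s => -> /= ss; apply: le_trans ss (ltW st).
have s1t : 0 <= s1 <= t by rewrite ltW //= (le_trans (ltW s1s)) // ltW.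
have [_] := bA (tr s1 s1t) y' w; have [+ _] := bA ctr w w.
rewrite -/(B y') -/(B w) => bP bQ.
have dA l : differentiable (A l) (c t).
  exact: smooth_on_differentiable (sA l) (ballU ctr).
have EB : B y' (c t) = B x' (c t) + B w (c t) by rewrite y'E /B pairingD.
have EDB : 'D_w (B y') (c t) = 'D_w (B x') (c t) + 'D_w (B w) (c t).
  by rewrite y'E /B !derive_pairing // pairingD.
have alg (b b' b'' b0 p q k l m : R) : b0 = b' + b'' -> m = l + k ->
    b - b0 = p * t -> p - m = q * s ->
    b - b' - (t * l + b'') = t * (s * q + k).
  move=> -> -> /eqP; rewrite subr_eq => /eqP -> /eqP; rewrite subr_eq => /eqP ->.
  by ring.
rewrite /B (closed_on_derive _ _ sA cA (ballU ctr)) -/(B w) -/(B x') -/(B y') yE.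
rewrite (alg _ _ _ _ _ _ _ _ _ EB EDB Es Es1).
have y'r : `|y'| <= r by move: yr; rewrite -ball_normE /ball_ /= distrC => /ltW.
(* Since [t] and [s] are at most 1 and [y'] has norm at most [r], the term in [Q] contributes
   [C * r] and the term in [P] contributes [C]. *)
have bound (P Q : R) : `|P| <= C * (`|w| * `|w|) ->
    `|Q| <= C * (`|y'| * (`|w| * `|w|)) ->
    `|t * (s * Q + P)| <= C * (r + 1) * (`|w| * `|w|).
  move=> leP leQ; apply: (@le_trans _ _ (`|Q| + `|P|)).
    rewrite normrM gtr0_norm // -[leRHS]mul1r; apply: ler_pM => //; first exact: ltW.
    apply: le_trans (ler_normD _ _) _; rewrite lerD2r normrM gtr0_norm //.
    by rewrite ler_piMl // (le_trans (ltW st)).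
  rewrite -mulrA mulrDl mul1r mulrDr; apply: lerD => //.
  apply: le_trans leQ _; rewrite ler_wpM2l // ler_wpM2r //.
exact: bound bP bQ.
Qed.

Lemma primitive_derive x : ball u r x ->
  differentiable primitive x /\ forall v, 'D_v primitive x = pairing A v x.
Proof.
move=> xr; pose lin := GRing.isLinear.Build _ _ _ _ _ (pairing_linear A x).
pose L : {linear 'rV[R]_N -> R} := HB.pack (pairing A ^~ x) lin.
have Lc : continuous L.
  move=> v; have -> : L = \sum_(l < N) (A l x \*: (fun w : 'rV[R]_N => w 0 l)) :> (_ -> _).
    by apply/funext => w; rewrite fct_sumE; apply: eq_bigr => l _; exact: mulrC.
  apply/differentiable_continuous/differentiable_sum => l.
  exact/differentiableZ/differentiable_coord.
apply: (differentiable_approx Lc) => e e0.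
have nx : \forall h \near (0 : 'rV[R]_N), ball u r (h + x).
  have : \forall y \near x, ball u r y by apply: open_nbhs_nbhs; split=> //; exact: ball_open.
  by rewrite (near_shift 0) /=; apply: filterS => h; rewrite subr0.
have r0 : 0 <= r by move: (xr); rewrite -ball_normE => /ltW; exact: le_trans.
(* The added 1 allows division even when [C = 0]. *)
have K0 : 0 < C * (r + 1) + 1 by rewrite ltr_wpDl // mulr_ge0 // addr_ge0.
have nh : \forall h \near (0 : 'rV[R]_N), `|h| < e / (C * (r + 1) + 1).
  by apply: nbhs0_lt; rewrite divr_gt0.
apply: filterS2 nx nh => h hxr he.
have := primitive_approx xr hxr; rewrite addrK => /le_trans; apply.
rewrite mulrA ler_wpM2r //.
apply: (@le_trans _ _ ((C * (r + 1) + 1) * `|h|)).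
  by rewrite ler_wpM2r // lerDl.
by rewrite mulrC -ler_pdivlMr // ltW.
Qed.

End Primitive.

Lemma poincare U A u : open U -> (forall l, smooth_on U (A l)) -> closed_on U A ->
  U u -> exists V : set 'rV[R]_N, [/\ open V, V u, V `<=` U &
    exists S, smooth_on V S /\ forall l x, V x -> partial l S x = A l x].
Proof.
move=> oU sA cA Uu.
have [C C0 AC] := pairing_bounds oU sA Uu.
have nU : nbhs u U by exact: open_nbhs_nbhs.
have /nbhs_ballP[d1 /= d10 d1U] := nU.
have /nbhs_ballP[d2 /= d20 d2A] := AC.
pose d := Num.min d1 d2; have d0 : 0 < d by rewrite lt_min d10.
have dU : ball u d `<=` U by move=> z zd; apply/d1U/(le_ball _ zd); rewrite ge_min lexx.
(* Halving keeps the extended rays, which reach distance [2 * r], inside [U]. *)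
pose r := d / 2; have r0 : 0 < r by rewrite divr_gt0.
have dE : 2 * r = d by rewrite mulrC divfK.
have rd : ball u r `<=` ball u d.
  by apply: le_ball; rewrite ler_pdivrMr // ler_peMr // ?ler1n // ltW.
have rU : ball u (2 * r) `<=` U by rewrite dE.
have rA : ball u r `<=` ball u d2.
  by move=> z /rd zd; apply: le_ball zd; rewrite ge_min lexx orbT.
have /choice[F FP] : forall x, exists G : R -> R, ball u r x ->
    forall t : R, 0 <= t <= 1 ->
    is_derive t 1 G (pairing A (x - u) (u + t *: (x - u))).
  move=> x; have [xr|xr] := pselect (ball u r x); last by exists (cst 0).
  by have [G GP] := radial_antiderivative oU sA rU xr; exists G.
have PD x := primitive_derive oU sA cA C0 rU (fun z zr => d2A z (rA z zr)) FP (x := x).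
have VU : ball u r `<=` U by move=> z /rd/dU.
exists (ball u r); split=> //; [exact: ball_open|exact: ballxx|].
exists (primitive F); split=> [|l x xr]; last first.
  by rewrite /partial (PD x xr).2 pairing_delta.
(* The directional derivatives of the primitive are contractions of [A], already known to be
   smooth. *)
apply: smooth_on_coinduction => [x /PD[]//|v].
apply: (@smooth_on_eq _ _ _ (pairing A v)); first exact: ball_open.
  by move=> x /PD[_ ->].
exact/(smooth_on_sub VU)/smooth_on_pairing.
Qed.

End PoincareLemma.

(** * Total derivatives on jets versus closed forms *)

Lemma nbhs_line (R : realType) (V : normedModType R) (x v : V) (A : set V) :
  nbhs x A -> \forall t \near (0 : R), A (x + t *: v).
Proof.
have lc : {for 0, continuous (fun t : R => x + t *: v)}.
  apply/differentiable_continuous/derivable1_diffP.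
  by apply: derivableD; [exact: derivable_cst|exact/diff_derivable/ex_diff].
by move=> xA; apply: lc; rewrite /= scale0r addr0.
Qed.

Section ExactForms.
Context {R : realType} {N : nat}.
Implicit Types (A : 'I_N -> 'rV[R]_N -> R) (U V : set 'rV[R]_N) (u z : 'rV[R]_N).

Lemma open_row0 K V : open V -> open [set M : 'M[R]_(K.+1, N) | V (row 0 M)].
Proof.
move=> oV; rewrite openE => M /= VM.
have /nbhs_ballP[e /= e0 eV] : nbhs (row 0 M) V by exact: open_nbhs_nbhs.
apply/nbhs_ballP; exists e => //= M' [_ MM'].
by apply: eV; split=> // i j; rewrite !mxE; exact: MM'.
Qed.

(** For small [t] the shifted jet still has its zeroth component in the open set [V], so [g] may be
    replaced by [h]; the shift affects row 0 only. *)
Lemma jet_partial0_density K V (h : 'M[R]_(K.+1, N) -> R) (g : @jet R N -> R) l J :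
  open V -> smooth_on [set M | V (row 0 M)] h ->
  (forall J, V (J 0%N) -> g J = h (\matrix_(k < K.+1) J k)) -> V (J 0%N) ->
  jet_partial 0 l g J = 'D_(delta_mx 0 l) h (\matrix_(k < K.+1) J k).
Proof.
move=> oV sh gh VJ; set M := \matrix_(k < K.+1) J k.
have VM : V (row 0 M) by rewrite rowK.
rewrite /jet_partial derive1E.
rewrite (@near_eq_derive _ _ _ _ (fun t : R => h (M + t *: delta_mx 0 l))).
  have /is_derive_line[_] : derivable h (M + 0 *: delta_mx 0 l) (delta_mx 0 l).
    by rewrite scale0r addr0; exact/diff_derivable/(smooth_on_differentiable sh).
  by rewrite scale0r addr0.
apply: filterS (nbhs_line (delta_mx 0 l) (open_nbhs_nbhs (conj oV VJ))) => t Vt.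
rewrite gh //; congr h; apply/row_matrixP => k; rewrite linearD linearZ /= !rowK.
rewrite /shift_jet; have [k0|k0] := eqVneq (k : nat) 0%N.
  have -> : k = 0 by exact/val_inj.
  by congr (_ + _ *: _); apply/rowP => j; rewrite !mxE.
rewrite [X in _ *: X](_ : _ = 0) ?scaler0 ?addr0 //.
by apply/rowP => j; rewrite !mxE -val_eqE /= (negPf k0).
Qed.

(** The truncated jet of a constant field. Its linearity makes derivatives of [h] along row 0
    restrict to derivatives in [z]. *)
Definition embed_jet K z : 'M[R]_(K.+1, N) :=
  \matrix_(k < K.+1) if k == 0 then z else 0.

Lemma embed_jetP K (a : R) v z : embed_jet K (a *: v + z) = a *: embed_jet K v + embed_jet K z.
Proof.
apply/row_matrixP => k; rewrite linearD linearZ /= !rowK.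
by case: ifP => // _; rewrite scaler0 addr0.
Qed.

Lemma embed_jet_delta K l : embed_jet K (delta_mx 0 l) = delta_mx 0 l.
Proof.
by apply/matrixP => k j; rewrite !mxE; case: eqP => _; rewrite ?mxE ?eqxx.
Qed.

Lemma derive_embed_jet K (f : 'M[R]_(K.+1, N) -> R) v z :
  'D_v (f \o embed_jet K) z = 'D_(embed_jet K v) f (embed_jet K z).
Proof.
rewrite /derive; set F := fun h : R => _; set G := fun h : R => _.
suff -> : F = G by [].
by rewrite /F /G; apply/funext => h /=; rewrite embed_jetP.
Qed.

Definition form_density A : @jet R N -> R :=
  fun J => \sum_(l < N) J 1%N 0 l * A l (J 0%N).

(* On the jet (z, eps e_l, 0, ...) every term of the total derivative but one
   vanishes, so the form is recovered by dividing by eps and letting eps -> 0. *)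
Lemma form_density_exact K V A (h : 'M[R]_(K.+1, N) -> R) (g : @jet R N -> R) l z :
  open V -> smooth_on [set M | V (row 0 M)] h ->
  (forall J, V (J 0%N) -> g J = h (\matrix_(k < K.+1) J k)) ->
  (forall J, V (J 0%N) -> form_density A J = total_derivative g J) ->
  V z -> A l z = 'D_(delta_mx 0 l) h (embed_jet K z).
Proof.
move=> oV sh gh Ag Vz.
pose e : 'rV[R]_N := delta_mx 0 l.
pose J (eps : R) : @jet R N := fun k =>
  if k is k'.+1 then (if k' is 0%N then eps *: e else 0) else z.
have JE eps : eps != 0 -> A l z = 'D_(delta_mx 0 l) h (\matrix_(k < K.+1) J eps k).
  move=> eps0; rewrite -(jet_partial0_density l oV sh gh) //.
  have := Ag (J eps) Vz.
  rewrite /total_derivative fsum_nat_only0; last first.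
    by case=> // k _; rewrite big1 // => i _; rewrite /J mxE mul0r.
  have single (F : 'I_N -> R) : \sum_(i < N) (eps *: e) 0 i * F i = eps * F l.
    rewrite (bigD1 l) //= big1 ?addr0; first by rewrite !mxE !eqxx mulr1.
    by move=> i il; rewrite !mxE eqxx (negPf il) mulr0 mul0r.
  by rewrite /form_density /= !single => /(mulfI eps0).
(* The direction in which the jet tends to [embed_jet K z]; for [K = 0] there is no row 1 and [B] is
   zero. *)
pose B : 'M[R]_(K.+1, N) := \matrix_(k < K.+1) if k == 1%N :> nat then e else 0.
have JB eps : \matrix_(k < K.+1) J eps k = embed_jet K z + eps *: B.
  apply/row_matrixP => k; rewrite linearD linearZ /= !rowK.
  by case: k => [[|[|k]] ?] /=; rewrite ?scaler0 ?addr0 ?add0r.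
have Vrow : V (row 0 (embed_jet K z)) by rewrite rowK.
pose Dh : 'M[R]_(K.+1, N) -> R := 'D_(delta_mx 0 l) h.
have cD : {for embed_jet K z, continuous Dh}.
  exact: smooth_on_continuous (smooth_on_derive _ sh) Vrow.
apply/eqP; rewrite eq_sym -subr_eq0 -normr_le0; apply/ler_addgt0Pr => d d0.
rewrite add0r; have := nbhs_line B (near_dist_lt cD d0).
(* [A l z] does not depend on [eps], so a single nonzero [eps] close to 0 suffices for each
   tolerance [d]. *)
move=> /nbhs_dnbhs nd; have ne := nbhs_dnbhs_neq (0 : R).
have [eps [/= Hd He]] := filter_ex (filterI nd ne).
by rewrite (JE eps He) JB; exact: ltW.
Qed.

Lemma vanishing_closed U A : functional_vanishes U (form_density A) -> closed_on U A.
Proof.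
move=> fv k l u Uu; have [V [oV Vu VU [g [[K [h [sh gh]]] Ag]]]] := fv u Uu.
have E i j : partial i (A j) u =
    'D_(delta_mx 0 i) ('D_(delta_mx 0 j) h) (embed_jet K u).
  rewrite -[in RHS](embed_jet_delta K i) -derive_embed_jet.
  apply: (derive_eq_on (A := V)) => // z; rewrite inE => Vz.
  exact: (form_density_exact j oV sh gh Ag Vz).
rewrite !E; apply: derive_swap (open_row0 oV) sh _.
by rewrite /= rowK.
Qed.

Lemma closed_vanishing U A : open U -> (forall l, smooth_on U (A l)) ->
  closed_on U A -> functional_vanishes U (form_density A).
Proof.
move=> oU sA cA u Uu; have [V [oV Vu VU [S [sS SA]]]] := poincare oU sA cA Uu.
exists V; split=> //; exists (order0_density S); split; last first.
  move=> J VJ; rewrite total_derivative_order0; apply: eq_bigr => l _.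
  by rewrite SA.
(* With [K = 0] the jet matrix has the single row [u], so [S] itself is the required function. *)
exists 0%N, S; split=> [|J VJ].
  rewrite (_ : [set M | _] = V) //; apply/seteqP; split=> M /=; rewrite row_id //.
by rewrite /order0_density; congr S; apply/rowP => j; rewrite !mxE.
Qed.

End ExactForms.

(** * Closedness of the bracket form and the nonlinear equations *)

Section BracketForm.
Context {R : realType} {N : nat}.
Variables (eta : 'M[R]_N) (U : set 'rV[R]_N) (phi psi : 'rV[R]_N -> R).
Hypotheses (eta_sym : eta^T = eta) (oU : open U).
Hypotheses (sphi : smooth_on U phi) (spsi : smooth_on U psi).

Lemma smooth_on_bracket_form l : smooth_on U (bracket_form eta phi psi l).
Proof.
apply: smooth_on_sum => // i; apply: smooth_on_sum => // j.
apply: (@smooth_onM _ _ _ (cst (eta i j))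
  (partial i phi * partial l (partial j psi))) => //; first exact: smooth_on_cst.
by apply: smooth_onM => //; do ![exact: sphi|exact: spsi|apply: smooth_on_partial].
Qed.

(** The Leibniz rule separates products of Hessians, which carry the equations, from a
    third-derivative term symmetric in [k] and [l]. *)
Lemma partial_bracket_form k l u : U u ->
  partial k (bracket_form eta phi psi l) u =
  \sum_(i < N) \sum_(j < N)
    eta i j * (partial k (partial i phi) u * partial l (partial j psi) u)
  + \sum_(i < N) \sum_(j < N)
    eta i j * (partial i phi u * partial k (partial l (partial j psi)) u).
Proof.
move=> Uu.
have dphi i : derivable (partial i phi) u (delta_mx 0 k).
  by apply/diff_derivable/(smooth_on_differentiable (smooth_on_partial i sphi)).
have dpsi j : derivable (partial l (partial j psi)) u (delta_mx 0 k).
  apply/diff_derivable/(smooth_on_differentiable _ Uu).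
  by do 2!apply: smooth_on_partial.
have -> : bracket_form eta phi psi l = \sum_(i < N) \sum_(j < N)
    (eta i j \*: (partial i phi * partial l (partial j psi))).
  apply/funext => z; rewrite fct_sumE; apply: eq_bigr => i _.
  by rewrite fct_sumE.
rewrite [LHS]derive_sum => [|i]; last first.
  by apply: derivable_sum => j; apply/derivableZ/derivableM.
rewrite -big_split; apply: eq_bigr => i _ /=.
rewrite derive_sum => [|j]; last exact/derivableZ/derivableM.
rewrite -big_split; apply: eq_bigr => j _ /=.
rewrite (deriveZ _ (derivableM (dphi i) (dpsi j))) (deriveM (dphi i) (dpsi j)).
have alg (e a b c d : R) : e * (a * b + c * d) = e * (d * c) + e * (a * b) by ring.
exact: (alg (eta i j) (partial i phi u) (partial k (partial l (partial j psi)) u)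
  (partial l (partial j psi) u) (partial k (partial i phi) u)).
Qed.

(** The symmetric term [T] cancels in the closedness condition, leaving [G i l = G l i]; symmetry of
    the Hessians and of [eta] identifies the two sides of the equations with these two values. *)
Lemma bracket_form_closedP :
  closed_on U (bracket_form eta phi psi) <->
  forall (i l : 'I_N) u, U u ->
    \sum_(m < N) \sum_(n < N)
      eta m n * partial i (partial m phi) u * partial n (partial l psi) u
    = \sum_(m < N) \sum_(n < N)
      eta m n * partial i (partial m psi) u * partial n (partial l phi) u.
Proof.
pose G i l u := \sum_(m < N) \sum_(n < N)
  eta m n * (partial i (partial m phi) u * partial l (partial n psi) u).
pose T i l u := \sum_(m < N) \sum_(n < N)
  eta m n * (partial m phi u * partial i (partial l (partial n psi)) u).
have lhsE i l u : U u ->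
    \sum_(m < N) \sum_(n < N)
      eta m n * partial i (partial m phi) u * partial n (partial l psi) u = G i l u.
  move=> Uu; apply: eq_bigr => m _; apply: eq_bigr => n _.
  by rewrite mulrA (partial_swap n l oU spsi Uu).
have rhsE i l u : U u ->
    \sum_(m < N) \sum_(n < N)
      eta m n * partial i (partial m psi) u * partial n (partial l phi) u = G l i u.
  move=> Uu; rewrite exchange_big; apply: eq_bigr => m _; apply: eq_bigr => n _ /=.
  by rewrite -[in LHS]eta_sym mxE mulrAC mulrA (partial_swap m l oU sphi Uu).
have TC i l u : U u -> T i l u = T l i u.
  move=> Uu; apply: eq_bigr => m _; apply: eq_bigr => n _.
  by rewrite (partial_swap i l oU (smooth_on_partial n spsi) Uu).
have formE i l u : U u -> partial i (bracket_form eta phi psi l) u = G i l u + T i l u.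
  exact: partial_bracket_form.
move: G T lhsE rhsE TC formE => G T lhsE rhsE TC formE.
split=> eqs i l u Uu.
  have := etrans (esym (formE i l u Uu)) (etrans (eqs i l u Uu) (formE l i u Uu)).
  rewrite (TC i l u Uu) => /addIr GC.
  exact: etrans (lhsE i l u Uu) (etrans GC (esym (rhsE i l u Uu))).
have GC : G i l u = G l i u.
  exact: etrans (esym (lhsE i l u Uu)) (etrans (eqs i l u Uu) (rhsE i l u Uu)).
apply: etrans (formE i l u Uu) (etrans _ (esym (formE l i u Uu))).
by rewrite GC (TC i l u Uu).
Qed.

End BracketForm.

Theorem lemma7p1 (R : realType) (N L : nat) (eta : 'M[R]_N)
    (eta_sym : eta^T = eta) (eta_nondegenerate : eta \in unitmx)
    (U : set 'rV[R]_N) (U_open : open U)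
    (psi : 'I_L -> 'rV[R]_N -> R)
    (psi_smooth : forall n : 'I_L, smooth_on U (psi n)) :
  (forall (i l : 'I_N) (j k : 'I_L) (u : 'rV[R]_N), U u ->
     \sum_(m < N) \sum_(n < N)
       eta m n * partial i (partial m (psi j)) u
               * partial n (partial l (psi k)) u
     = \sum_(m < N) \sum_(n < N)
       eta m n * partial i (partial m (psi k)) u
               * partial n (partial l (psi j)) u)
  <->
  (forall n m : 'I_L,
     functional_vanishes U
       (poisson_bracket eta (order0_density (psi n)) (order0_density (psi m)))).
Proof.
have bracketE n m :
    poisson_bracket eta (order0_density (psi n)) (order0_density (psi m))
    = form_density (bracket_form eta (psi n) (psi m)).
  by apply/funext => J; exact: poisson_bracket_order0.
have closedP n m :=
  bracket_form_closedP eta_sym U_open (psi_smooth n) (psi_smooth m).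
(* Each pair of indices is treated separately: its instance of the equations is closedness of its
   own bracket form. *)
split=> [eqs n m|inv i l j k u Uu].
  rewrite bracketE.
  have cl := (closedP n m).2 (fun i l u => eqs i l n m u).
  exact: closed_vanishing U_open
    (smooth_on_bracket_form eta U_open (psi_smooth n) (psi_smooth m)) cl.
have cl : closed_on U (bracket_form eta (psi j) (psi k)).
  by apply: vanishing_closed; rewrite -bracketE.
exact: (closedP j k).1 cl i l u Uu.
Qed.
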